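(* Let $f\in\mathcal{C}$ and $\theta_0\in\mathbb{R}$, and let $\pi$ be a sample from $\mathbb{Q}_{n,f,\theta_0}$. Set $$y_\pi(i,j):=f(i/n,\pi(i)/n)+f(j/n,\pi(j)/n)-f(i/n,\pi(j)/n)-f(j/n,\pi(i)/n).$$ Then, with probability tending to $1$ as $n\to\infty$, the expression $$PL_n(\pi,\theta):=\sum_{1\le i<j\le n}y_\pi(i,j)\,\frac{1}{1+e^{\theta y_\pi(i,j)}}$$ has a unique root in $\theta\in\mathbb{R}$. Further, denoting this root by $\hat\theta_n$, the sequence $\sqrt n(\hat\theta_n-\theta_0)$ is $O_P(1)$ under $\mathbb{Q}_{n,f,\theta_0}$.
   Context: $S_n$ is the set of permutations of $\{1,\dots,n\}$. $\mathcal{C}$ is the set of all continuous functions $f:[0,1]^2\to\mathbb{R}$, not identically $0$, with $\int_0^1 f(x,z)\,dz=0$ for all $x\in[0,1]$ and $\int_0^1 f(z,y)\,dz=0$ for all $y\in[0,1]$. For $\theta\in\mathbb{R}$, $\mathbb{Q}_{n,f,\theta}$ is the probability mass function on $S_n$ given by $\mathbb{Q}_{n,f,\theta}(\pi)=e^{\theta\sum_{i=1}^n f(i/n,\pi(i)/n)-Z_n(f,\theta)}$, where $Z_n(f,\theta)=\log\sum_{\pi\in S_n}e^{\theta\sum_{i=1}^n f(i/n,\pi(i)/n)}$. $O_P(1)$ means bounded in probability (tight). On the event (of vanishing probability) where a unique root does not exist, $\hat\theta_n$ is defined arbitrarily. *)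

(* Defs.v *)
From HB Require Import structures.
From mathcomp Require Import all_boot all_order all_algebra all_fingroup.
From mathcomp Require Import all_classical all_reals all_analysis.
Set Implicit Arguments. Unset Strict Implicit. Unset Printing Implicit Defensive.
Import Order.TTheory GRing.Theory Num.Theory.
Import numFieldNormedType.Exports.
Local Open Scope classical_set_scope.
Local Open Scope ring_scope.

Definition unit_square (R : realType) : set (R * R) := `[0, 1] `*` `[0, 1].

(* The class C.  Functions on the unit square are represented by total
   functions on R * R of which only the values on the square matter. *)
Definition classC (R : realType) (f : R * R -> R) : Prop :=
  [/\ {within @unit_square R, continuous f},
      exists2 p : R * R, unit_square p & f p != 0,
      forall x : R, x \in `[0, 1] ->
        (\int[lebesgue_measure]_(z in `[0%R, 1%R]) (f (x, z))%:E = 0)%E &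
      forall y : R, y \in `[0, 1] ->
        (\int[lebesgue_measure]_(z in `[0%R, 1%R]) (f (z, y))%:E = 0)%E].

(* 'S_n permutes {0, ..., n-1}; the ordinal i stands for the 1-based index
   i + 1, so the grid points are (i + 1) / n. *)
Definition grid (R : realType) (n : nat) (i : 'I_n) : R := i.+1%:R / n%:R.

Definition fsum (R : realType) (f : R * R -> R) (n : nat) (s : 'S_n) : R :=
  \sum_(i < n) f (grid R i, grid R (s i)).

Definition logZ (R : realType) (f : R * R -> R) (theta : R) (n : nat) : R :=
  ln (\sum_(s : 'S_n) expR (theta * fsum f s)).

Definition Qpmf (R : realType) (f : R * R -> R) (theta : R) (n : nat)
    (s : 'S_n) : R :=
  expR (theta * fsum f s - logZ f theta n).

Definition Qprob (R : realType) (f : R * R -> R) (theta : R) (n : nat)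
    (E : set 'S_n) : R :=
  \sum_(s : 'S_n | `[< E s >]) Qpmf f theta s.

Definition ypi (R : realType) (f : R * R -> R) (n : nat) (s : 'S_n)
    (i j : 'I_n) : R :=
  f (grid R i, grid R (s i)) + f (grid R j, grid R (s j))
  - f (grid R i, grid R (s j)) - f (grid R j, grid R (s i)).

Definition PL (R : realType) (f : R * R -> R) (n : nat) (s : 'S_n)
    (theta : R) : R :=
  \sum_(i < n) \sum_(j < n | (i < j)%N)
    ypi f s i j * (1 / (1 + expR (theta * ypi f s i j))).

Definition has_unique_root (R : realType) (f : R * R -> R) (n : nat)
    (s : 'S_n) : Prop :=
  exists! theta : R, PL f s theta = 0.

(* The value on permutations without a unique root is unconstrained. *)
Definition is_PL_estimator (R : realType) (f : R * R -> R)
    (that : forall n : nat, 'S_n -> R) : Prop :=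
  forall (n : nat) (s : 'S_n), has_unique_root f s -> PL f s (that n s) = 0.

(* X n = O_P(1) (tightness) when the n-th sample is drawn from Q_{n,f,theta}. *)
Definition OP1_under_Q (R : realType) (f : R * R -> R) (theta : R)
    (X : forall n : nat, 'S_n -> R) : Prop :=
  forall eps : R, 0 < eps ->
    exists M : R, forall n : nat, (0 < n)%N ->
      Qprob f theta [set s : 'S_n | M < `|X n s| ] <= eps.

(* Main.v *)
Require Import Defs.
From HB Require Import structures.
From mathcomp Require Import all_boot all_order all_algebra all_fingroup.
From mathcomp Require Import all_classical all_reals all_analysis.
From mathcomp Require Import ring lra.
Import Order.TTheory GRing.Theory Num.Theory.
Import numFieldNormedType.Exports.
Local Open Scope classical_set_scope.
Local Open Scope ring_scope.

(** Why the theorem holds.  Exchanging the values of a permutation at i and j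
    multiplies its probability by exp (- theta * y_ij), so that, given all other
    values, the exchange happens with probability w_ij = 1 / (1 + exp (theta *
    y_ij)).  Hence for a function G_ij of the two values that changes sign under
    the exchange, w_ij G_ij is centred, and uncorrelated with everything the
    exchange does not move.  A double sum of such terms therefore has second
    moment O(n^3) rather than O(n^4) ([swap_second_moment]).  This one estimate
    is used twice.

    Score.  With G_ij = y_ij for i < j the double sum is PL_n(theta0), so the
    score is of order n^(3/2) ([PL_second_moment]).

    Information.  PL_n is decreasing in the parameter, with slope at least a
    constant times the sum of y_ij^2 over i < j ([PL_decrease]); this sum has to
    be of order n^2.  Apply the estimate to G_ij = phi(i, s j) - phi(i, s i),
    where phi is the indicator of a rectangle U x V: as w_ij is bounded away from
    0, the number of points of the graph of s in U x V is at least a fixed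
    fraction of |U| |V| / n, with probability 1 - O(1/n)
    ([graph_count_lower_bound]).  This replaces the limit theory of permutations.  If y
    vanished for all choices of two points of the square, integrating the
    resulting identity would give f = 0 because the marginals of f vanish
    ([cross_nonzero]); so by continuity there are two rectangles between which
    |y| is bounded below, and both contain order n points of the graph
    ([curvature_lower_bound]).

    Both parts follow by the intermediate value theorem and strict monotonicity:
    outside an event of probability O(1 / (n t^2)), PL_n has exactly one root,
    and it lies within t of theta0 ([root_localization]).  Existence and
    uniqueness is the case t = 1, tightness the case t = M / sqrt n. *)

(** * Expectations and probabilities under the Gibbs measure *)

Section Expectation.
Context {R : realType} (f : R * R -> R) (theta : R) {n : nat}.

Definition Qmean (X : 'S_n -> R) : R := \sum_(s : 'S_n) Qpmf f theta s * X s.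

Lemma Qpmf_ge0 (s : 'S_n) : 0 <= Qpmf f theta s.
Proof. exact: expR_ge0. Qed.

Lemma sum_Qpmf : \sum_(s : 'S_n) Qpmf f theta s = 1.
Proof.
set Z := \sum_(s : 'S_n) expR (theta * fsum f s).
have Z0 : 0 < Z.
  rewrite /Z (bigD1 (1%g : 'S_n)) //= ltr_pwDl ?expR_gt0 //.
  by apply: sumr_ge0 => s _; exact: expR_ge0.
rewrite /Qpmf.
under eq_bigr => s _ do rewrite expRD expRN /logZ lnK ?posrE //.
by rewrite -mulr_suml divff // gt_eqF.
Qed.

Lemma QprobE (E : set 'S_n) :
  Qprob f theta E = \sum_(s : 'S_n) Qpmf f theta s * (`[< E s >])%:R.
Proof.
rewrite /Qprob big_mkcond /=; apply: eq_bigr => s _.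
by case: ifP => _; rewrite ?mulr1 ?mulr0.
Qed.

Lemma Qprob_le (E E' : set 'S_n) :
  E `<=` E' -> Qprob f theta E <= Qprob f theta E'.
Proof.
move=> EE'; rewrite !QprobE; apply: ler_sum => s _.
apply: ler_wpM2l; first exact: Qpmf_ge0.
rewrite ler_nat; case: asboolP => // Es.
by case: asboolP => // /(_ (EE' _ Es)).
Qed.

Lemma Qprob_setU (E E' : set 'S_n) :
  Qprob f theta (E `|` E') <= Qprob f theta E + Qprob f theta E'.
Proof.
rewrite !QprobE -big_split /=; apply: ler_sum => s _.
rewrite -mulrDr; apply: ler_wpM2l; first exact: Qpmf_ge0.
rewrite -natrD ler_nat; case: asboolP => //= -[] Es.
- by case: asboolP.
- by case: (asboolP (E' s)) => //; rewrite addn1.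
Qed.

Lemma Qprob_setC (E : set 'S_n) : Qprob f theta (~` E) = 1 - Qprob f theta E.
Proof.
apply/eqP; rewrite eq_sym subr_eq eq_sym -sum_Qpmf !QprobE -big_split /=; apply/eqP.
apply: eq_bigr => s _; rewrite -mulrDr asbool_neg.
by case: asboolP => _; rewrite ?add0r ?addr0 mulr1.
Qed.

Lemma Qprob_ge0 (E : set 'S_n) : 0 <= Qprob f theta E.
Proof. by apply: sumr_ge0 => s _; exact: Qpmf_ge0. Qed.

Lemma Qprob_chebyshev (X : 'S_n -> R) (t : R) : 0 < t ->
  Qprob f theta [set s | t <= `|X s|] <= Qmean (fun s => X s ^+ 2) / t ^+ 2.
Proof.
move=> t0; rewrite ler_pdivlMr ?exprn_gt0 // QprobE mulr_suml.
apply: ler_sum => s _; rewrite -mulrA; apply: ler_wpM2l; first exact: Qpmf_ge0.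
case: asboolP => /= [tX|_]; last by rewrite mul0r sqr_ge0.
by rewrite mul1r -(real_normK (num_real (X s))) ler_pXn2r ?nnegrE // ltW.
Qed.

End Expectation.

(** * Exchanging two values of the permutation *)

Section Swap.
Context {R : realType} (f : R * R -> R) (theta : R) {n : nat}.
Implicit Types (i j k l a b : 'I_n) (s : 'S_n).

(** [ypi] as a function of the values of the permutation at [i] and [j] only;
    [ypi f s i j] is convertible to [cross i j (s i) (s j)]. *)
Definition cross i j a b : R :=
  f (grid R i, grid R a) + f (grid R j, grid R b)
  - f (grid R i, grid R b) - f (grid R j, grid R a).

(** The conditional probability of [tperm i j * s] given that the permutation is
    either [s] or [tperm i j * s]. *)
Definition swap_prob s i j : R := (1 + expR (theta * ypi f s i j))^-1.

Lemma swap_prob_ge0 s i j : 0 <= swap_prob s i j.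
Proof. by rewrite invr_ge0 addr_ge0 // expR_ge0. Qed.

Lemma swap_prob_le1 s i j : swap_prob s i j <= 1.
Proof. by rewrite invf_le1 ?ltr_pwDl ?expR_ge0 // lerDl expR_ge0. Qed.

Lemma fsum_tperm s i j : fsum f (tperm i j * s)%g = fsum f s - ypi f s i j.
Proof.
have [->|ij] := eqVneq i j.
  by rewrite tperm1 mul1g /ypi; ring.
rewrite /fsum (bigD1 i) // (bigD1 j) 1?eq_sym //=.
rewrite [in RHS](bigD1 i) // [in RHS](bigD1 j) 1?eq_sym //=.
rewrite !permM tpermL tpermR.
under eq_bigr => k /andP[ki kj].
  rewrite permM tpermD; [over|by rewrite eq_sym|by rewrite eq_sym].
rewrite /ypi; ring.
Qed.

Lemma ypi_tperm s i j : ypi f (tperm i j * s)%g i j = - ypi f s i j.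
Proof. by rewrite /ypi !permM tpermL tpermR; ring. Qed.

Lemma Qpmf_tperm s i j :
  Qpmf f theta (tperm i j * s)%g
  = Qpmf f theta s * expR (- (theta * ypi f s i j)).
Proof. by rewrite /Qpmf -expRD fsum_tperm; congr expR; ring. Qed.

(** Detailed balance for the Markov chain that resamples the values at [i] and
    [j]: the two flows between [s] and [tperm i j * s] agree. *)
Lemma Qpmf_swap_balance s i j :
  Qpmf f theta (tperm i j * s)%g * swap_prob (tperm i j * s)%g i j
  = Qpmf f theta s * swap_prob s i j.
Proof.
rewrite Qpmf_tperm /swap_prob ypi_tperm mulrN expRN -mulrA; congr (_ * _).
have e0 := expR_gt0 (theta * ypi f s i j).
by field; apply/andP; split; rewrite ?gt_eqF //; lra.
Qed.

(** By detailed balance the change of variables [s -> tperm i j * s] turns the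
    expectation into its opposite. *)
Lemma Qmean_swap_eq0 (G : 'I_n -> 'I_n -> R) (H : 'S_n -> R) i j :
  (forall a b, G b a = - G a b) ->
  (forall s, H (tperm i j * s)%g = H s) ->
  Qmean f theta (fun s => swap_prob s i j * G (s i) (s j) * H s) = 0.
Proof.
move=> Ga Hi; apply/eqP; rewrite -eqNr /Qmean; apply/eqP.
rewrite -sumrN [RHS](reindex_inj (mulgI (tperm i j))) /=.
apply: eq_bigr => s _.
have si : (tperm i j * s)%g i = s j by rewrite permM tpermL.
have sj : (tperm i j * s)%g j = s i by rewrite permM tpermR.
rewrite si sj Hi (Ga (s i)).
have := Qpmf_swap_balance s i j.
set u := Qpmf _ _ (_ * _)%g.
set v := swap_prob (_ * _)%g _ _.
move: (Qpmf f theta s) (swap_prob s i j) (G (s i) (s j)) (H s) => x y z w E.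
by rewrite mulrN mulNr mulrN !mulrA E.
Qed.

(** Expand the square.  The product of the terms of two disjoint pairs of indices
    has mean zero, since the second term is unchanged by the exchange of the
    first pair; only the at most [4 * n ^ 3] products of overlapping pairs
    remain, each at most [B ^ 2]. *)
Lemma swap_second_moment (G : 'I_n -> 'I_n -> 'I_n -> 'I_n -> R) (B : R) :
  (forall i j a b, G i j b a = - G i j a b) ->
  (forall i j a b, `|G i j a b| <= B) ->
  Qmean f theta (fun s =>
    (\sum_i \sum_j swap_prob s i j * G i j (s i) (s j)) ^+ 2)
  <= 4 * B ^+ 2 * n%:R ^+ 3.
Proof.
move=> Ga GB.
pose psi s i j := swap_prob s i j * G i j (s i) (s j).
have psiB s i j : `|psi s i j| <= B.
  rewrite normrM ger0_norm ?swap_prob_ge0 // -[leRHS]mul1r.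
  by apply: ler_pM; rewrite ?swap_prob_ge0 ?swap_prob_le1.
have psiT s i j k l : i != k -> i != l -> j != k -> j != l ->
    psi (tperm i j * s)%g k l = psi s k l.
  by move=> ? ? ? ?; rewrite /psi /swap_prob /ypi !permM !tpermD.
(* The right-hand side counts the coincidences between the two pairs, an
   overestimate of the indicator of overlap that is easy to sum. *)
have cov i j k l : Qmean f theta (fun s => psi s i j * psi s k l)
    <= B ^+ 2 * ((i == k)%:R + (i == l)%:R + (j == k)%:R + (j == l)%:R).
  have B0 : 0 <= B ^+ 2 by exact: sqr_ge0.
  have [ov|/norP[ik /norP[il /norP[jk jl]]]] :=
      boolP [|| i == k, i == l, j == k | j == l].
    apply: (@le_trans _ _ (B ^+ 2)).
      rewrite -[leRHS]mul1r -(sum_Qpmf f theta (n := n)) mulr_suml.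
      apply: ler_sum => s _; apply: ler_wpM2l; first exact: Qpmf_ge0.
      apply: (le_trans (ler_norm _)); rewrite normrM expr2.
      by apply: ler_pM.
    rewrite ler_peMr // -!natrD ler1n; move: ov.
    by do 4 case: (_ == _).
  rewrite Qmean_swap_eq0 //; last by move=> s; rewrite psiT.
  by rewrite mulr_ge0 // !addr_ge0.
pose psi2 s (p : 'I_n * 'I_n) := psi s p.1 p.2.
have sq s : (\sum_i \sum_j psi s i j) ^+ 2
    = \sum_p \sum_q psi2 s p * psi2 s q.
  by rewrite pair_big expr2 mulr_suml; apply: eq_bigr => p _; rewrite mulr_sumr.
have sum_row (i : 'I_n) : \sum_(q : 'I_n * 'I_n) (i == q.1)%:R = n%:R :> R.
  rewrite -(pair_big xpredT xpredT (fun a b : 'I_n => (i == a)%:R : R)) /=.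
  rewrite (bigD1 i) //= eqxx sumr_const card_ord big1 ?addr0 // => k.
  by rewrite eq_sym => /negbTE->; rewrite sumr_const mul0rn.
have sum_col (i : 'I_n) : \sum_(q : 'I_n * 'I_n) (i == q.2)%:R = n%:R :> R.
  rewrite -(pair_big xpredT xpredT (fun a b : 'I_n => (i == b)%:R : R)) /=.
  by rewrite exchange_big /= pair_big sum_row.
rewrite /Qmean.
under eq_bigr => s _ do rewrite sq mulr_sumr.
rewrite exchange_big /=.
have -> : 4 * B ^+ 2 * n%:R ^+ 3
    = \sum_(p : 'I_n * 'I_n) B ^+ 2 * (n%:R + n%:R + n%:R + n%:R).
  rewrite sumr_const card_prod card_ord -[RHS]mulr_natr natrM; ring.
apply: ler_sum => p _.
under eq_bigr => s _ do rewrite mulr_sumr.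
have <- : \sum_(q : 'I_n * 'I_n) (p.1 == q.1)%:R
    + \sum_(q : 'I_n * 'I_n) (p.1 == q.2)%:R
    + \sum_(q : 'I_n * 'I_n) (p.2 == q.1)%:R
    + \sum_(q : 'I_n * 'I_n) (p.2 == q.2)%:R
    = n%:R + n%:R + n%:R + n%:R :> R by rewrite !sum_row !sum_col.
rewrite exchange_big -!big_split /= mulr_sumr; apply: ler_sum => q _.
exact: cov.
Qed.
End Swap.

(** * The pseudolikelihood score as a function of the parameter *)

(** A lower bound for minus the derivative of the logistic function
    [a |-> 1 / (1 + expR a)] at the points with [`|a| <= L]. *)
Definition curvature_factor {R : realType} (L : R) : R := expR (- L) / (1 + expR L) ^+ 2.

Lemma curvature_factor_gt0 {R : realType} (L : R) : 0 < curvature_factor L.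
Proof. by rewrite divr_gt0 ?expR_gt0 ?exprn_gt0 // addr_gt0 // expR_gt0. Qed.

(** Over a common denominator the numerator is [expR b - expR a], which is at
    least [expR a * (b - a)] by convexity of the exponential. *)
Lemma logistic_gap (R : realType) (L a b : R) : `|a| <= L -> `|b| <= L ->
  a <= b ->
  curvature_factor L * (b - a)
  <= (1 + expR a)^-1 - (1 + expR b)^-1.
Proof.
move=> aL bL ab.
have ea := expR_gt0 a; have eb := expR_gt0 b; have eL := expR_gt0 L.
have -> : (1 + expR a)^-1 - (1 + expR b)^-1
    = (expR b - expR a) / ((1 + expR a) * (1 + expR b)).
  by field; apply/andP; split; rewrite gt_eqF //; lra.
have num : expR (- L) * (b - a) <= expR b - expR a.
  have -> : expR b - expR a = expR a * (expR (b - a) - 1).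
    by rewrite mulrBr mulr1 -expRD; congr (expR _ - _); ring.
  apply: ler_pM; rewrite ?expR_ge0 ?subr_ge0 //.
    by rewrite ler_expR; move: aL; rewrite ler_norml => /andP[].
  by rewrite lerBrDl expR_ge1Dx.
rewrite /curvature_factor mulrAC; apply: ler_pM => //.
- by rewrite mulr_ge0 ?expR_ge0 ?subr_ge0.
- rewrite lef_pV2 ?posrE ?mulr_gt0 ?exprn_gt0 ?addr_gt0 // expr2.
  apply: ler_pM; rewrite ?addr_ge0 ?expR_ge0 // lerD2l ler_expR.
    exact: (le_trans (ler_norm _)).
  exact: (le_trans (ler_norm _)).
Qed.

Section Pseudolikelihood.
Context {R : realType} (f : R * R -> R) {n : nat}.
Implicit Types s : 'S_n.

(** The negative of the derivative of [PL f s], up to weights that are bounded above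
    and away from zero for bounded parameters. *)
Definition curvature s : R := \sum_(i < n) \sum_(j < n | (i < j)%N) ypi f s i j ^+ 2.

(** Each term [y / (1 + expR (theta * y))] decreases in [theta], whatever the sign
    of [y]: for negative [y] both [theta * y] and the outer factor are reversed. *)
Lemma PL_decrease s (K T t1 t2 : R) :
  (forall i j, `|ypi f s i j| <= K) -> `|t1| <= T -> `|t2| <= T -> t1 <= t2 ->
  curvature_factor (T * K) * curvature s * (t2 - t1) <= PL f s t1 - PL f s t2.
Proof.
move=> yK t1T t2T t12.
rewrite /PL /curvature mulrAC mulr_sumr -sumrB; apply: ler_sum => i _.
rewrite mulr_sumr -sumrB; apply: ler_sum => j _.
move: (ypi f s i j) (yK i j) => y yK'.
have tyL t : `|t| <= T -> `|t * y| <= T * K.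
  by move=> tT; rewrite normrM; exact: ler_pM.
rewrite !div1r -mulrBr.
have [y0|y0] := leP 0 y.
  have := @logistic_gap _ _ _ _ (tyL _ t1T) (tyL _ t2T) (ler_wpM2r y0 t12).
  move=> /(ler_wpM2l y0) h; apply: le_trans h.
  by rewrite le_eqVlt; apply/orP; left; apply/eqP; ring.
have ny0 : 0 <= - y by lra.
have := @logistic_gap _ _ _ _ (tyL _ t2T) (tyL _ t1T) (ler_wnM2r (ltW y0) t12).
move=> /(ler_wpM2l ny0) h.
rewrite -[leRHS]mulrNN opprB; apply: le_trans h.
by rewrite le_eqVlt; apply/orP; left; apply/eqP; ring.
Qed.

(** When the curvature is positive, [PL f s] has slope bounded above by a negative
    constant on every bounded interval of parameters. *)
Lemma PL_injective s (t1 t2 : R) : 0 < curvature s ->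
  PL f s t1 = 0 -> PL f s t2 = 0 -> t1 = t2.
Proof.
move=> S0.
wlog : t1 t2 / t1 <= t2.
  move=> wl p1 p2; have [h|/ltW h] := leP t1 t2; first exact: wl.
  by apply/esym/wl.
move=> t12 p1 p2.
pose K : R := \sum_i \sum_j `|ypi f s i j|.
have yK i j : `|ypi f s i j| <= K.
  rewrite /K (bigD1 i) //= (bigD1 j) //= -addrA lerDl addr_ge0 ?sumr_ge0 // => k _.
  by apply: sumr_ge0.
have := @PL_decrease s K (`|t1| + `|t2|) t1 t2 yK.
rewrite lerDl lerDr !normr_ge0 p1 p2 subrr => /(_ isT isT t12).
rewrite pmulr_rle0; last by apply: mulr_gt0 => //; exact: curvature_factor_gt0.
rewrite subr_le0 => t21.
by apply/le_anti; rewrite t12 t21.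
Qed.

Lemma PL_continuous s : continuous (PL f s).
Proof.
apply: (continuous_big add_continuous) => i _.
apply: (continuous_big add_continuous) => j _ t.
apply: cvgM; first exact: cvg_cst.
under eq_fun do rewrite div1r.
rewrite div1r.
apply: cvgV; first by rewrite gt_eqF // ltr_pwDl // expR_ge0.
apply: cvgD; first exact: cvg_cst.
apply: (@cvg_comp _ _ _ (fun t : R => t * ypi f s i j) expR _
  (nbhs (t * ypi f s i j))).
  by apply: cvgM; [exact: cvg_id|exact: cvg_cst].
exact: continuous_expR.
Qed.

(** The slope carries the score from its value at [theta] across zero within
    distance [t], to the right or to the left. *)
Lemma PL_root_near s (K theta t c : R) :
  (forall i j, `|ypi f s i j| <= K) -> 0 < t -> t <= 1 ->
  0 < c -> c <= curvature s ->
  `|PL f s theta| <= curvature_factor ((`|theta| + 1) * K) * c * t ->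
  exists2 r : R, `|r - theta| <= t & PL f s r = 0.
Proof.
move=> yK t0 t1 c0 cS P.
set k := curvature_factor _ in P.
have k0 : 0 < k := curvature_factor_gt0 _.
have kc : k * c * t <= k * curvature s * t.
  by rewrite ler_pM2r // ler_pM2l.
have hT (x : R) : `|x| <= 1 -> `|theta + x| <= `|theta| + 1.
  by move=> x1; apply: (le_trans (ler_normD _ _)); rewrite lerD2l.
have T0 : `|theta| <= `|theta| + 1 by rewrite lerDl.
have tn : `|t| <= 1 by rewrite gtr0_norm.
have tn' : `|- t| <= 1 by rewrite normrN.
have up := @PL_decrease s K _ theta (theta + t) yK T0 (hT _ tn).
have dn := @PL_decrease s K _ (theta - t) theta yK (hT _ tn') T0.
move: up dn; rewrite -/k.
have -> : theta + t - theta = t by ring.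
have -> : theta - (theta - t) = t by ring.
move=> /(_ ltac:(lra)) up /(_ ltac:(lra)) dn.
move: P; rewrite ler_norml => /andP[P1 P2].
have le : theta - t <= theta + t by lra.
have := @IVT _ (PL f s) _ _ 0 le.
case.
- exact/continuous_subspaceT/PL_continuous.
- by rewrite ge_min le_max; apply/andP; split; apply/orP; [right|left]; lra.
move=> r; rewrite in_itv /= => /andP[r1 r2] pr; exists r => //.
by rewrite ler_norml; apply/andP; split; lra.
Qed.

End Pseudolikelihood.

(** * Consequences of the second moment bound *)

Section Bounded.
Context {R : realType} (f : R * R -> R) (F : R).
Context (fF : forall p, unit_square p -> `|f p| <= F).

Lemma grid_itv n (i : 'I_n) : grid R i \in `[0, 1].
Proof.
have n0 : (0 : R) < n%:R by rewrite ltr0n (leq_ltn_trans _ (ltn_ord i)).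
rewrite in_itv /= /grid divr_ge0 //= ler_pdivrMr // mul1r ler_nat.
exact: ltn_ord.
Qed.

Lemma cross_bound n (i j a b : 'I_n) : `|cross f i j a b| <= 4 * F.
Proof.
have h (k l : 'I_n) : `|f (grid R k, grid R l)| <= F.
  by apply: fF; split => /=; exact: grid_itv.
have := h i a; have := h j b; have := h i b; have := h j a.
rewrite /cross !ler_norml.
by do 4 move=> /andP[? ?]; apply/andP; split; lra.
Qed.

(** The score is the double sum of [swap_second_moment] for the antisymmetric
    function [cross], restricted to [i < j]; the constant is [4 * (4 * F) ^ 2]. *)
Lemma PL_second_moment theta n :
  Qmean f theta (fun s : 'S_n => PL f s theta ^+ 2) <= 64 * F ^+ 2 * n%:R ^+ 3.
Proof.
pose G (i j a b : 'I_n) : R := if (i < j)%N then cross f i j a b else 0.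
have F0 : 0 <= 4 * F.
  rewrite mulr_ge0 // (le_trans _ (@fF (0, 0) _)) //.
  by split => /=; rewrite in_itv /= lexx ler01.
have := @swap_second_moment _ f theta n G (4 * F).
have -> : 4 * (4 * F) ^+ 2 * n%:R ^+ 3 = 64 * F ^+ 2 * n%:R ^+ 3 :> R by ring.
have -> : (fun s : 'S_n => PL f s theta ^+ 2) = (fun s =>
    (\sum_i \sum_j swap_prob f theta s i j * G i j (s i) (s j)) ^+ 2).
  apply/funext => s; congr (_ ^+ 2); apply: eq_bigr => i _.
  rewrite big_mkcond; apply: eq_bigr => j _.
  by rewrite /G; case: ifP => _; rewrite ?mulr0 // div1r mulrC.
apply=> i j a b; rewrite /G; case: ifP => _; rewrite ?oppr0 ?normr0 //.
  by rewrite /cross; ring.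
exact: cross_bound.
Qed.

Definition min_swap_prob (theta : R) : R := (1 + expR (`|theta| * (4 * F)))^-1.

Lemma min_swap_prob_gt0 theta : 0 < min_swap_prob theta.
Proof. by rewrite invr_gt0 ltr_pwDl // expR_ge0. Qed.

Lemma swap_prob_min theta {n} (s : 'S_n) i j :
  min_swap_prob theta <= swap_prob f theta s i j.
Proof.
rewrite lef_pV2 ?posrE ?ltr_pwDl ?expR_ge0 // lerD2l ler_expR.
apply: (le_trans (ler_norm _)); rewrite normrM ler_wpM2l //.
exact: cross_bound.
Qed.

Definition graph_count {n : nat} (U V : {set 'I_n}) (s : 'S_n) : R :=
  \sum_i ((i \in U) && (s i \in V))%:R.

(** Let [phi] be the indicator of [U x V].  Terms where [phi i (s j) = 1] are
    weighted by at least [min_swap_prob], those where [phi i (s i) = 1] by at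
    most 1, so the double sum [X] of the antisymmetric function
    [phi i (s j) - phi i (s i)] is at least
    [min_swap_prob * #|U| * #|V| - n * graph_count U V].  If [graph_count U V] were small, [X]
    would be of order [n ^ 2], which [swap_second_moment] makes unlikely. *)
Lemma graph_count_lower_bound theta n (U V : {set 'I_n}) (c : R) :
  (0 < n)%N -> 0 < c -> c * n%:R <= #|U|%:R -> c * n%:R <= #|V|%:R ->
  Qprob f theta [set s : 'S_n |
    graph_count U V s < min_swap_prob theta * c ^+ 2 / 2 * n%:R]
  <= 16 / (min_swap_prob theta * c ^+ 2) ^+ 2 / n%:R.
Proof.
move=> n0 c0 cU cV; set k := min_swap_prob theta.
have k0 : 0 < k := min_swap_prob_gt0 theta.
have nR : (0 : R) < n%:R by rewrite ltr0n.
pose phi (i a : 'I_n) : R := ((i \in U) && (a \in V))%:R.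
pose G (i j a b : 'I_n) : R := phi i b - phi i a.
pose X s := \sum_i \sum_j swap_prob f theta s i j * G i j (s i) (s j).
pose t := k * c ^+ 2 / 2 * n%:R ^+ 2.
have t0 : 0 < t by rewrite !mulr_gt0 ?exprn_gt0 // invr_gt0.
have phi0 i a : 0 <= phi i a by [].
have phi1 i a : phi i a <= 1 by rewrite /phi; case: (_ && _).
(* Since [s] is a bijection, this part of [X] does not depend on [s]. *)
have card_phi (s : 'S_n) : \sum_i \sum_j phi i (s j) = #|U|%:R * #|V|%:R.
  rewrite -!sumr_const big_distrlr /= [RHS]big_mkcond; apply: eq_bigr => i _.
  transitivity (\sum_j phi i j); first by rewrite [RHS](reindex_inj (@perm_inj _ s)).
  case: ifPn => [iU|iU]; last first.
    by rewrite big1 // => j _; rewrite /phi (negbTE iU).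
  rewrite [RHS]big_mkcond; apply: eq_bigr => j _.
  by rewrite /phi iU mulr1; case: (j \in V).
have XE s : k * (#|U|%:R * #|V|%:R) - n%:R * graph_count U V s <= X s.
  rewrite -(card_phi s) /graph_count !mulr_sumr -sumrB; apply: ler_sum => i _.
  have -> : n%:R * ((i \in U) && (s i \in V))%:R = \sum_(j < n) phi i (s i).
    by rewrite sumr_const card_ord mulr_natl.
  rewrite mulr_sumr -sumrB; apply: ler_sum => j _.
  have := swap_prob_min theta s i j; rewrite -/k.
  have := swap_prob_le1 f theta s i j; have := swap_prob_ge0 f theta s i j.
  have := phi0 i (s i); have := phi0 i (s j); rewrite /G; nra.
apply: (@le_trans _ _ (Qprob f theta [set s | t <= `|X s|])).
  apply: Qprob_le => s /= hs; apply: (le_trans _ (ler_norm _)).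
  apply: le_trans (XE s).
  have cc : k * (c ^+ 2 * n%:R ^+ 2) <= k * (#|U|%:R * #|V|%:R).
    rewrite ler_pM2l // -exprMn expr2; apply: ler_pM => //.
    - by rewrite mulr_ge0 // ltW.
    - by rewrite mulr_ge0 // ltW.
  have : n%:R * graph_count U V s <= n%:R * (k * c ^+ 2 / 2 * n%:R).
    by rewrite ler_pM2l // ltW.
  have -> : n%:R * (k * c ^+ 2 / 2 * n%:R) = t by rewrite /t; ring.
  have tt : k * (c ^+ 2 * n%:R ^+ 2) = t + t by rewrite /t; field.
  by move: cc; rewrite tt => cc h; lra.
apply: (le_trans (Qprob_chebyshev f theta X t t0)).
rewrite ler_pdivrMr ?exprn_gt0 //.
have := @swap_second_moment _ f theta n G 1 => /(_ _ _)/le_trans; apply.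
- by move=> i j a b; rewrite /G opprB.
- move=> i j a b; rewrite /G ler_norml.
  have := phi0 i a; have := phi0 i b; have := phi1 i a; have := phi1 i b.
  by move=> ? ? ? ?; apply/andP; split; lra.
rewrite le_eqVlt; apply/orP; left; apply/eqP; rewrite /t; field.
by rewrite !gt_eqF.
Qed.
End Bounded.

(** * Functions with vanishing marginals *)

Section ClassC.
Context {R : realType} (f : R * R -> R).

Lemma classC_bounded : classC f ->
  exists F : R, forall p, unit_square p -> `|f p| <= F.
Proof.
case=> cf _ _ _.
have : bounded_set (f @` @unit_square R).
  apply: compact_bounded; apply: continuous_compact => //.
  by apply: compact_setX; exact: segment_compact.
move=> /pinfty_ex_gt0 [M M0 h]; exists M => p sp.
by apply: h; exists p.
Qed.

Lemma classC_section (x : R) : classC f -> x \in `[0, 1] ->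
  (@lebesgue_measure R).-integrable `[0, 1] (EFin \o (fun z => f (x, z))).
Proof.
case=> cf _ _ _ xI; apply: continuous_compact_integrable.
  exact: segment_compact.
move: cf => /subspace_continuousP cf; apply/subspace_continuousP => z zI.
have := cf (x, z) (conj xI zI).
apply: (@cvg_comp _ _ _ (fun z : R => (x, z)) f).
move=> P [[A B] [/= nA nB] AB]; apply: filterS nB => u Bu uI.
by apply: (AB (x, u)) => //; split => //; exact: nbhs_singleton.
Qed.

(** Otherwise [f (x1, y) - f (x2, y)] does not depend on [y]; its integral over [y]
    is zero, so [f (x, y)] does not depend on [x] either, and its integral over
    [x] is zero, which makes [f] vanish. *)
Lemma cross_nonzero : classC f ->
  exists x1 y1 x2 y2 : R,
    [/\ x1 \in `[0, 1], y1 \in `[0, 1], x2 \in `[0, 1] & y2 \in `[0, 1]] /\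
    f (x1, y1) + f (x2, y2) - f (x1, y2) - f (x2, y1) != 0.
Proof.
move=> Cf; apply: contrapT => noex.
have rect x1 y1 x2 y2 : x1 \in `[0, 1] -> y1 \in `[0, 1] -> x2 \in `[0, 1] ->
    y2 \in `[0, 1] -> f (x1, y2) - f (x2, y2) = f (x1, y1) - f (x2, y1).
  move=> h1 h2 h3 h4; apply: contrapT => ne; apply: noex.
  exists x1, y1, x2, y2; split=> //; apply/eqP => e; apply: ne; lra.
have [cf [[x1 y1] [/= x1I y1I] /eqP fne] rows cols] := Cf.
apply: fne.
have cstI (c : R) : (\int[lebesgue_measure]_(z in `[0%R, 1%R]) c%:E = c%:E)%E.
  rewrite integral_cst //= lebesgue_measure_itv /= lte_fin ltr01.
  by rewrite sube0 mule1.
have eqx x2 : x2 \in `[0, 1] -> f (x1, y1) = f (x2, y1).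
  move=> x2I; apply/eqP; rewrite -subr_eq0 -eqe; apply/eqP.
  rewrite -[LHS]cstI.
  transitivity (\int[lebesgue_measure]_(z in `[0%R, 1%R])
    ((f (x1, z))%:E - (f (x2, z))%:E))%E.
    by apply: eq_integral => z; rewrite inE => zI; rewrite -EFinB (rect x1 y1 x2 z).
  by rewrite integralB_EFin ?rows ?sube0 //; exact: classC_section.
apply/eqP; rewrite -eqe; apply/eqP.
rewrite -[LHS]cstI -[RHS](cols y1 y1I); apply: eq_integral => z.
by rewrite inE => zI; rewrite (eqx z).
Qed.

Lemma interval_near (x d : R) : x \in `[0, 1] -> 0 < d ->
  exists a b : R, [/\ 0 <= a, a < b, b <= 1 &
    forall z, a < z -> z <= b -> `|z - x| < d].
Proof.
rewrite in_itv /= => /andP[x0 x1] d0.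
exists (Num.max 0 (x - d / 2)), (Num.min 1 (x + d / 2)); split.
- by rewrite le_max lexx.
- by rewrite gt_max !lt_min ltr01 /=; apply/andP; split; [|apply/andP; split]; lra.
- by rewrite ge_min lexx.
- move=> z; rewrite gt_max le_min => /andP[_ h1] /andP[_ h2].
  by rewrite ltr_norml; apply/andP; split; lra.
Qed.

Lemma rectangle_continuous (x y e : R) : {within @unit_square R, continuous f} ->
  unit_square (x, y) -> 0 < e ->
  exists2 d : R, 0 < d & forall u v, unit_square (u, v) -> `|u - x| < d ->
    `|v - y| < d -> `|f (u, v) - f (x, y)| < e.
Proof.
move=> /subspace_continuousP cf sq e0.
have /cvgrPdist_lt /(_ _ e0) := cf _ sq.
rewrite near_withinE => -[[A B] /= [nA nB] AB].
have [d1 /= d10 h1] := nA; have [d2 /= d20 h2] := nB.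
exists (Num.min d1 d2); first by rewrite lt_min d10.
move=> u v uv; rewrite !lt_min => /andP[u1 _] /andP[_ v2].
rewrite distrC; apply: (AB (u, v)) => //; split.
  by apply: h1 => /=; rewrite distrC.
by apply: h2 => /=; rewrite distrC.
Qed.

End ClassC.

(** The indices [l + k] with [k < m], where [l] and [m] are the integer parts of
    [a * n] and [(b - a) * n], all belong to the set: the grid point of index
    [i] is [(i + 1) / n], which accounts for the strict lower bound.  The
    rounding loss of at most one index is absorbed in the factor 1/2. *)
Lemma card_grid_interval (R : realType) (a b : R) (n : nat) :
  0 <= a -> a < b -> b <= 1 -> 2 / (b - a) <= n%:R ->
  (b - a) / 2 * n%:R <= #|[set i : 'I_n | (a < grid R i) && (grid R i <= b)]%SET|%:R.
Proof.
move=> a0 ab b1 nbig.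
have ba : 0 < b - a by lra.
have n0 : (0 : R) < n%:R by apply: lt_le_trans nbig; rewrite divr_gt0.
have nba : 2 <= (b - a) * n%:R by rewrite mulrC -ler_pdivrMr.
pose m := Num.trunc ((b - a) * n%:R).
pose l := Num.trunc (a * n%:R).
have /andP[m1 m2] : m%:R <= (b - a) * n%:R < m.+1%:R.
  by apply: truncn_itv; lra.
have /andP[l1 l2] : l%:R <= a * n%:R < l.+1%:R.
  by apply: truncn_itv; rewrite mulr_ge0 // ltW.
have lm k : (k < m)%N -> (l + k < n)%N.
  move=> km; rewrite -(ltr_nat R) natrD.
  have : k.+1%:R <= m%:R :> R by rewrite ler_nat.
  rewrite -natr1 => km'.
  have : b * n%:R <= 1 * n%:R by rewrite ler_pM2r.
  move: m1 l1; rewrite mulrBl mul1r; lra.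
set U := [set i : 'I_n | _]%SET.
have inU (k : 'I_m) : Ordinal (lm k (ltn_ord k)) \in U.
  rewrite inE /grid /= ltr_pdivlMr // ler_pdivrMr //; apply/andP; split.
    by apply: (lt_le_trans l2); rewrite ler_nat ltnS leq_addr.
  have : k.+1%:R <= m%:R :> R by rewrite ler_nat.
  rewrite -addnS natrD; move: m1 l1; rewrite mulrBl; lra.
have mU : (m <= #|U|)%N.
  have inj : injective (fun k : 'I_m => Ordinal (lm k (ltn_ord k))).
    by move=> k k' [] /addnI /val_inj.
  rewrite -[m]card_ord -cardsT -(card_imset _ inj).
  by apply/subset_leq_card/fintype.subsetP => i /imsetP[k _ ->]; exact: inU.
apply: (@le_trans _ _ m%:R); last by rewrite ler_nat.
move: m2; rewrite -natr1; lra.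
Qed.

Lemma card_grid_near (R : realType) (x d : R) : x \in `[0, 1] -> 0 < d ->
  exists2 c : R, 0 < c & forall n : nat, c^-1 <= n%:R ->
    c * n%:R <= #|[set i : 'I_n | `|grid R i - x| < d]%SET|%:R.
Proof.
move=> xI d0; have [a [b [a0 ab b1 near]]] := interval_near x d xI d0.
exists ((b - a) / 2); first lra.
move=> n; rewrite invf_div => nbig.
apply: (le_trans (card_grid_interval _ _ _ _ a0 ab b1 nbig)).
rewrite ler_nat; apply/subset_leq_card/fintype.subsetP => i.
by rewrite !inE => /andP[? ?]; exact: near.
Qed.

(** * The information is of order n^2 *)

Lemma curvature_double (R : realType) (f : R * R -> R) {n} (s : 'S_n) :
  \sum_i \sum_j ypi f s i j ^+ 2 = 2 * curvature f s.
Proof.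
pose up (i j : 'I_n) : R := if (i < j)%N then ypi f s i j ^+ 2 else 0.
have ysym i j : ypi f s j i = ypi f s i j by rewrite /ypi; ring.
have -> : \sum_i \sum_j ypi f s i j ^+ 2 = \sum_i \sum_j (up i j + up j i).
  apply: eq_bigr => i _; apply: eq_bigr => j _; rewrite /up.
  case: (ltngtP i j) => [_|_|/val_inj->]; rewrite ?addr0 ?add0r //.
    by rewrite ysym.
  by rewrite /ypi; ring.
under eq_bigr do rewrite big_split.
rewrite big_split /= [X in _ + X]exchange_big /= mulr_natl mulr2n.
by congr (_ + _); apply: eq_bigr => i _; rewrite -big_mkcond.
Qed.

Lemma graph_count_curvature (R : realType) (f : R * R -> R) {n}
    (U1 V1 U2 V2 : {set 'I_n}) (e : R) (s : 'S_n) : 0 <= e ->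
  (forall i a j b, i \in U1 -> a \in V1 -> j \in U2 -> b \in V2 ->
     e <= `|cross f i j a b|) ->
  e ^+ 2 * (graph_count U1 V1 s * graph_count U2 V2 s) <= 2 * curvature f s.
Proof.
move=> e0 he; rewrite -curvature_double /graph_count big_distrlr mulr_sumr.
apply: ler_sum => i _; rewrite mulr_sumr; apply: ler_sum => j _ /=.
case: (boolP (_ && _)) => [/andP[iU sV]|_]; last by rewrite mul0r mulr0 sqr_ge0.
case: (boolP (_ && _)) => [/andP[jU tV]|_]; last by rewrite !mulr0 sqr_ge0.
rewrite !mulr1 -[leRHS]real_normK ?num_real // lerXn2r ?nnegrE //.
exact: he.
Qed.

Lemma alternating_sum_perturb (R : realType) (a b c d a' b' c' d' : R) :
  let Y := a + b - c - d in
  `|a' - a| < `|Y| / 8 -> `|b' - b| < `|Y| / 8 ->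
  `|c' - c| < `|Y| / 8 -> `|d' - d| < `|Y| / 8 ->
  `|Y| / 2 <= `|a' + b' - c' - d'|.
Proof.
move=> Y ha hb hc hd.
have eqY : Y = a' + b' - c' - d' + (c' - c) + (d' - d) - (a' - a) - (b' - b).
  by rewrite /Y; ring.
have : `|Y| <= `|a' + b' - c' - d'| + `|c' - c| + `|d' - d| + `|a' - a| + `|b' - b|.
  rewrite {1}eqY.
  do 2 (apply: (le_trans (ler_normB _ _)); apply: lerD => //).
  by do 2 (apply: (le_trans (ler_normD _ _)); apply: lerD => //).
by move: ha hb hc hd; clear; lra.
Qed.

(** Two small rectangles around the points [(x1, y1)] and [(x2, y2)] of
    [cross_nonzero] contribute of order [n ^ 2] pairs of points of the graph,
    each with [|ypi|] at least half the value [|Y|] at the centres. *)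
Lemma curvature_lower_bound (R : realType) (f : R * R -> R) (theta : R) :
  classC f ->
  exists c C : R, [/\ 0 < c, 0 <= C & exists n0 : R, forall n : nat,
    (0 < n)%N -> n0 <= n%:R ->
    Qprob f theta [set s : 'S_n | curvature f s < c * n%:R ^+ 2] <= C / n%:R].
Proof.
move=> Cf; have [F fF] := classC_bounded f Cf.
have [x1 [y1 [x2 [y2 [[x1I y1I x2I y2I] Y0]]]]] := cross_nonzero f Cf.
set Y := _ - _ in Y0.
have Yp : 0 < `|Y| by rewrite normr_gt0.
have e0 : 0 < `|Y| / 8 by lra.
have cf : {within @unit_square R, continuous f} by case: Cf.
(* [cross] involves the values of [f] at all four corners; an error of [|Y| / 8]
   at each of them leaves half of [|Y|]. *)
have [d11 d11p h11] := rectangle_continuous f x1 y1 _ cf (conj x1I y1I) e0.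
have [d12 d12p h12] := rectangle_continuous f x1 y2 _ cf (conj x1I y2I) e0.
have [d21 d21p h21] := rectangle_continuous f x2 y1 _ cf (conj x2I y1I) e0.
have [d22 d22p h22] := rectangle_continuous f x2 y2 _ cf (conj x2I y2I) e0.
pose d := Num.min (Num.min d11 d12) (Num.min d21 d22).
have dp : 0 < d by rewrite !lt_min d11p d12p d21p d22p.
have [c1 c1p k1] := card_grid_near _ x1 d x1I dp.
have [c2 c2p k2] := card_grid_near _ x2 d x2I dp.
have [c3 c3p k3] := card_grid_near _ y1 d y1I dp.
have [c4 c4p k4] := card_grid_near _ y2 d y2I dp.
pose c := Num.min (Num.min c1 c2) (Num.min c3 c4).
have cp : 0 < c by rewrite !lt_min c1p c2p c3p c4p.
have [cc1 cc2 cc3 cc4] : [/\ c <= c1, c <= c2, c <= c3 & c <= c4].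
  by rewrite /c !ge_min !lexx ?orbT.
pose k := min_swap_prob F theta.
have k0 : 0 < k := min_swap_prob_gt0 F theta.
pose h := k * c ^+ 2 / 2.
have h0 : 0 < h by rewrite divr_gt0 ?mulr_gt0 ?exprn_gt0.
exists ((`|Y| / 2) ^+ 2 * h ^+ 2 / 2), (32 / (k * c ^+ 2) ^+ 2).
split; first by rewrite !mulr_gt0 ?exprn_gt0 ?invr_gt0.
  by rewrite divr_ge0 ?sqr_ge0.
exists c^-1 => n npos nbig.
have nR : (0 : R) < n%:R by rewrite ltr0n.
have card z c' : 0 < c' -> c <= c' ->
    (forall m : nat, c'^-1 <= m%:R ->
      c' * m%:R <= #|[set i : 'I_m | `|grid R i - z| < d]%SET|%:R) ->
    c * n%:R <= #|[set i : 'I_n | `|grid R i - z| < d]%SET|%:R.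
  move=> c'p cc' hc'; apply: (@le_trans _ _ (c' * n%:R)); first by rewrite ler_pM2r.
  by apply: hc'; apply: le_trans nbig; rewrite lef_pV2.
have {k1}k1 := card _ _ c1p cc1 k1; have {k2}k2 := card _ _ c2p cc2 k2.
have {k3}k3 := card _ _ c3p cc3 k3; have {k4}k4 := card _ _ c4p cc4 k4.
set U1 := [set i : 'I_n | _]%SET in k1; set U2 := [set i : 'I_n | _]%SET in k2.
set V1 := [set i : 'I_n | _]%SET in k3; set V2 := [set i : 'I_n | _]%SET in k4.
have far i a j b : i \in U1 -> a \in V1 -> j \in U2 -> b \in V2 ->
    `|Y| / 2 <= `|cross f i j a b|.
  rewrite !inE !lt_min => /andP[/andP[i1 i2] /andP[i3 i4]].
  move=> /andP[/andP[a1 a2] /andP[a3 a4]].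
  move=> /andP[/andP[j1 j2] /andP[j3 j4]].
  move=> /andP[/andP[b1 b2] /andP[b3 b4]].
  have sq (u v : 'I_n) : unit_square (grid R u, grid R v).
    by split; exact: grid_itv.
  have := h11 _ _ (sq i a) i1 a1; have := h12 _ _ (sq i b) i2 b2.
  have := h21 _ _ (sq j a) j3 a3; have := h22 _ _ (sq j b) j4 b4.
  by move=> g22 g21 g12 g11; exact: alternating_sum_perturb.
have P1 := @graph_count_lower_bound _ f F fF theta n U1 V1 c npos cp k1 k3.
have P2 := @graph_count_lower_bound _ f F fF theta n U2 V2 c npos cp k2 k4.
rewrite -/k -/h in P1 P2.
have -> : 32 / (k * c ^+ 2) ^+ 2 / n%:R
    = 16 / (k * c ^+ 2) ^+ 2 / n%:R + 16 / (k * c ^+ 2) ^+ 2 / n%:R.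
  by rewrite -!mulrDl; congr (_ / _ / _); ring.
apply: le_trans (lerD P1 P2); apply: le_trans (Qprob_setU _ _ _ _).
apply: Qprob_le => s /= small; apply: contrapT => /not_orP[/= /negP n1 /negP n2].
move: small; apply/negP; rewrite -leNgt.
rewrite -leNgt in n1; rewrite -leNgt in n2.
have := @graph_count_curvature _ f n U1 V1 U2 V2 (`|Y| / 2) s _ far.
have Y2 : 0 <= `|Y| / 2 by rewrite divr_ge0.
move=> /(_ Y2) hc.
have hh : (h * n%:R) ^+ 2 <= graph_count U1 V1 s * graph_count U2 V2 s.
  by rewrite expr2; apply: ler_pM => //; rewrite mulr_ge0 // ltW.
have Y20 : 0 <= (`|Y| / 2) ^+ 2 by exact: sqr_ge0.
have := le_trans (ler_wpM2l Y20 hh) hc.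
rewrite [(h * n%:R) ^+ 2]exprMn mulrA [2 * _]mulrC => final.
by rewrite mulrAC ler_pdivrMr.
Qed.

(** * Localization of the root *)

(** The root exists, is unique and is close to [theta] as soon as the curvature is
    at least [c * n ^ 2] and the score at [theta] is at most
    [k * c * n ^ 2 * t]; the latter fails with probability at most of order
    [n ^ 3 / (n ^ 2 * t) ^ 2], by Chebyshev's inequality.  The bound is kept
    uniform in [t] because [t] is a constant for the existence of the root
    and of order [1 / sqrt n] for the tightness. *)
Lemma root_localization (R : realType) (f : R * R -> R) (theta : R) :
  classC f ->
  exists D : R, 0 <= D /\ exists n0 : R, forall (n : nat) (t : R),
    (0 < n)%N -> n0 <= n%:R -> 0 < t -> t <= 1 ->
    Qprob f theta [set s : 'S_n |
      ~ exists2 r, `|r - theta| <= t & unique (fun x => PL f s x = 0) r]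
    <= D / (n%:R * t ^+ 2).
Proof.
move=> Cf; have [F fF] := classC_bounded f Cf.
have [c [C [c0 C0 [n0 low]]]] := curvature_lower_bound _ f theta Cf.
pose k := curvature_factor ((`|theta| + 1) * (4 * F)).
have k0 : 0 < k := curvature_factor_gt0 _.
have kc2 : 0 < (k * c) ^+ 2 by rewrite exprn_gt0 // mulr_gt0.
exists (C + 64 * F ^+ 2 / (k * c) ^+ 2); split.
  apply: addr_ge0 => //; apply: divr_ge0; last exact: ltW.
  by apply: mulr_ge0 => //; exact: sqr_ge0.
exists n0 => n t npos nbig t0 t1.
have nR : (0 : R) < n%:R by rewrite ltr0n.
have n20 : (0 : R) < n%:R ^+ 2 by rewrite exprn_gt0.
pose z := k * (c * n%:R ^+ 2) * t.
have z0 : 0 < z.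
  by apply: mulr_gt0 => //; apply: mulr_gt0 => //; exact: mulr_gt0.
have P1 := low n npos nbig.
have P2 := @Qprob_chebyshev _ f theta n (fun s => PL f s theta) z z0.
rewrite mulrDl.
have Q1 : C / n%:R <= C / (n%:R * t ^+ 2).
  apply: ler_wpM2l => //; rewrite lef_pV2 ?posrE ?mulr_gt0 ?exprn_gt0 //.
  by apply: ler_piMr; rewrite ?(ltW nR) // exprn_ile1 // ltW.
have Q2 : Qmean f theta (fun s : 'S_n => PL f s theta ^+ 2) / z ^+ 2
    <= 64 * F ^+ 2 / (k * c) ^+ 2 / (n%:R * t ^+ 2).
  rewrite ler_pdivrMr ?exprn_gt0 //.
  apply: (le_trans (@PL_second_moment _ f F fF theta n)).
  rewrite le_eqVlt; apply/orP; left; apply/eqP; rewrite /z; field.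
  by rewrite !gt_eqF.
apply: le_trans (lerD (le_trans P1 Q1) (le_trans P2 Q2)).
apply: le_trans (Qprob_setU _ _ _ _).
apply: Qprob_le => s /= noroot.
apply: contrapT => /not_orP[/= /negP n1 /negP n2]; apply: noroot.
rewrite -leNgt in n1; rewrite -ltNge in n2.
have c20 : 0 < c * n%:R ^+ 2 by exact: mulr_gt0.
have yK i j : `|ypi f s i j| <= 4 * F by exact: cross_bound.
have [r rt pr] := @PL_root_near _ f n s (4 * F) theta t _ yK t0 t1 c20 n1 (ltW n2).
exists r => //; split => // x px.
by apply: (@PL_injective _ f n s) => //; exact: lt_le_trans n1.
Qed.

Theorem theorem1p10 (R : realType) (f : R * R -> R) (theta0 : R) :
  classC f ->
  (Qprob f theta0 [set s : 'S_n | has_unique_root f s] @[n --> \oo] --> (1 : R))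
  /\
  (forall that : forall n : nat, 'S_n -> R,
     is_PL_estimator f that ->
     OP1_under_Q f theta0
       (fun n (s : 'S_n) => Num.sqrt (n%:R : R) * (that n s - theta0))).
Proof.
move=> Cf; have [D [D0 [n0 loc]]] := root_localization _ f theta0 Cf.
split.
  apply/cvgrPdist_le => e e0.
  near=> n.
  have npos : (0 < n)%N by near: n; exists 1%N.
  have nR : (0 : R) < n%:R by rewrite ltr0n.
  rewrite -Qprob_setC ger0_norm ?Qprob_ge0 //.
  apply: (@le_trans _ _ (D / (n%:R * 1 ^+ 2))).
    apply: le_trans (loc n 1 npos _ ltr01 (lexx _)); last first.
      by near: n; exact: nbhs_infty_ger.
    by apply: Qprob_le => s /= nu [r _ ur]; apply: nu; exists r.
  rewrite expr1n mulr1 ler_pdivrMr // mulrC -ler_pdivrMr //.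
  by near: n; exact: nbhs_infty_ger.
move=> that est e e0.
pose M := Num.max 1 (D / e).
have M1 : 1 <= M by rewrite le_max lexx.
have M0 : 0 < M by exact: lt_le_trans M1.
(* From [N] on, [root_localization] applies with [t = M / sqrt n]; the finitely
   many earlier sample sizes are covered by the crude bound [M'], below which
   [|X n s|] stays for every permutation. *)
pose N := (Num.trunc (Num.max n0 (M ^+ 2))).+1.
pose X n (s : 'S_n) := Num.sqrt (n%:R : R) * (that n s - theta0).
pose M' : R := \sum_(n < N) \sum_(s : 'S_n) `|X n s|.
have M'0 : 0 <= M' by rewrite sumr_ge0 // => n _; rewrite sumr_ge0.
exists (M + M') => n npos.
have nR : (0 : R) < n%:R by rewrite ltr0n.
have [nN|Nn] := ltnP n N.
  suff -> : [set s : 'S_n | M + M' < `|X n s|] = set0.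
    by rewrite /Qprob big1 ?ltW // => s; rewrite asboolE.
  apply/seteqP; split => // s /=; apply/negP; rewrite -leNgt.
  apply: (@le_trans _ _ M'); last by rewrite lerDr ltW.
  rewrite /M' (bigD1 (Ordinal nN)) //= (bigD1 s) //= -addrA lerDl.
  by rewrite addr_ge0 // sumr_ge0 // => m _; rewrite sumr_ge0.
have /andP[n0n Mn] : (n0 <= n%:R) && (M ^+ 2 <= n%:R).
  rewrite -ge_max; apply: (le_trans (ltW (truncnS_gt _))).
  by rewrite ler_nat.
have sn : 0 < Num.sqrt (n%:R : R) by rewrite sqrtr_gt0.
pose t := M / Num.sqrt (n%:R : R).
have t0 : 0 < t by exact: divr_gt0.
have t1 : t <= 1.
  rewrite ler_pdivrMr // mul1r -(@ler_pXn2r _ 2) ?nnegrE ?(ltW M0) ?(ltW sn) //.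
  by rewrite sqr_sqrtr // ltW.
have nt : n%:R * t ^+ 2 = M ^+ 2.
  by rewrite /t expr_div_n sqr_sqrtr ?ltW // mulrCA mulfV ?gt_eqF // mulr1.
apply: le_trans (_ : D / (n%:R * t ^+ 2) <= _); last first.
  rewrite nt ler_pdivrMr ?exprn_gt0 // mulrC -ler_pdivrMr //.
  apply: (@le_trans _ _ M); first by rewrite le_max lexx orbT.
  by rewrite expr2 ler_peMr // ltW.
apply: le_trans (loc n t npos n0n t0 t1).
apply: Qprob_le => s /= big [r rt ur].
move: big; apply/negP; rewrite -leNgt.
have hu : has_unique_root f s by exists r.
rewrite -(ur.2 _ (est n s hu)) normrM (gtr0_norm sn).
apply: (@le_trans _ _ M); last by rewrite lerDl.
by rewrite mulrC -ler_pdivlMr.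
Unshelve. all: by end_near.
Qed.
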